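(* Let $0<\beta<mn$, $\tilde\delta\in\mathbb R$ and let $\vec p=(p_1,\dots,p_m)$ be a vector of exponents, $1\le p_i\le\infty$. If $\vec v\in\mathcal H_m(\vec p,\beta,\tilde\delta)$ and $\xi=p/(mp-1)>1$, then $\tilde\delta=\beta-n/p$.
   Context: Notation. $m\in\mathbb N$; $1/p=\sum_{i=1}^m 1/p_i$; $p_i'$ is the conjugate exponent of $p_i$, so that $1/\xi=m-1/p=\sum_{i=1}^m1/p_i'$; $|B|$ is Lebesgue measure; $w^{-1}(B)=\int_B w^{-1}$. A weight is a locally integrable function $w$ on $\mathbb R^n$ with $0<w(x)<\infty$ for almost every $x$; $\vec v=(v_1,\dots,v_m)$ is a vector of weights. Class of weights. Let $\delta$ be a fixed real number. For a weight $w$ and a vector of weights $\vec v$, $(w,\vec v)\in\mathcal H_m(\vec p,\beta,\tilde\delta)$ means that $w^{-1}$ is locally integrable and there are numbers $\beta_1,\dots,\beta_m$ with $0<\beta_i<n$, $\sum_{i=1}^m\beta_i=\beta$, and a constant $C>0$ such that $$\frac{|B|^{1+(\delta-\tilde\delta)/n}}{w^{-1}(B)}\prod_{i=1}^m\left\|\frac{v_i^{-1}}{(|B|^{1/n}+|x_B-\cdot|)^{n-\beta_i+\delta/m}}\right\|_{p_i'}\le C$$ for every ball $B=B(x_B,R)$. One writes $\vec v\in\mathcal H_m(\vec p,\beta,\tilde\delta)$ when $(w,\vec v)\in\mathcal H_m(\vec p,\beta,\tilde\delta)$ with $w=\prod_{i=1}^m v_i$. *)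

(* Defs.v *)
From HB Require Import structures.
From mathcomp Require Import all_boot all_order all_algebra.
From mathcomp Require Import all_classical all_reals all_analysis.
From mathcomp Require Import measurable_realfun ess_sup_inf.

Set Implicit Arguments.
Unset Strict Implicit.
Unset Printing Implicit Defensive.
Import Order.TTheory GRing.Theory Num.Theory.
Import numFieldNormedType.Exports.

Local Open Scope classical_set_scope.
Local Open Scope ring_scope.

(* The sigma-algebra on ['rV[R]_n] generated by the coordinate maps, that is,
   the Borel sigma-algebra of R^n. *)
Section borel_rV.
Context {R : realType} {n : nat}.

Definition rV_coord (i : 'I_n) (x : 'rV[R]_n) : measurableTypeR R := x ord0 i.

Let G : set (set 'rV[R]_n) := g_sigma_preimage rV_coord.

Let G0 : G set0. Proof. exact: sigma_algebra0. Qed.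

Let GC A : G A -> G (~` A). Proof. exact: sigma_algebraC. Qed.

Let GU (F : (set 'rV[R]_n)^nat) : (forall i, G (F i)) -> G (\bigcup_i F i).
Proof. exact: sigma_algebra_bigcup. Qed.

HB.instance Definition _ := @isMeasurable.Build
  (measure_tuple_display default_measure_display) 'rV[R]_n G G0 GC GU.

Lemma measurable_rV_coord (i : 'I_n) :
  measurable_fun [set: 'rV[R]_n] (rV_coord i).
Proof.
move=> _ Y mY; rewrite setTI; apply: sub_sigma_algebra => /=.
rewrite -bigcup_seq/=; exists i => /=; first by rewrite mem_index_enum.
by exists Y => //; rewrite setTI.
Qed.

Lemma measurable_fun_rVP d (T : measurableType d) (f : T -> 'rV[R]_n) :
  (forall i, measurable_fun [set: T] (rV_coord i \o f)) ->
  measurable_fun [set: T] f.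
Proof.
move=> mf.
suff H : g_sigma_preimage (fun i => rV_coord i \o f) `<=` measurable.
  by move=> _ A mA; apply: H; rewrite g_sigma_preimage_comp; exists A.
apply: smallest_sub; first exact: sigma_algebra_measurable.
rewrite -bigcup_seq; apply: bigcup_sub => i _ A [B mB <-].
exact: mf.
Qed.

End borel_rV.

Section borel_measure_step.
Context {R : realType} {n : nat}.

Definition rV_cons (z : measurableTypeR R * 'rV[R]_n) : 'rV[R]_n.+1 :=
  \row_(i < n.+1) (if unlift ord0 i is Some j then z.2 ord0 j else z.1).

Definition rV_uncons (x : 'rV[R]_n.+1) : measurableTypeR R * 'rV[R]_n :=
  (x ord0 ord0, \row_(j < n) x ord0 (lift ord0 j)).

Lemma rV_consK : cancel rV_cons rV_uncons.
Proof.
case=> a x; rewrite /rV_uncons mxE unlift_none; congr pair.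
by apply/rowP => j; rewrite !mxE liftK.
Qed.

Lemma measurable_rV_cons : measurable_fun setT rV_cons.
Proof.
apply: measurable_fun_rVP => i.
case: (unliftP ord0 i) => [j|] ->.
- rewrite (_ : _ \o _ = rV_coord j \o snd).
    exact: measurableT_comp (measurable_rV_coord j) measurable_snd.
  by apply/funext => z; rewrite /rV_coord /= mxE liftK.
- rewrite (_ : _ \o _ = fst); first exact: measurable_fst.
  by apply/funext => z; rewrite /rV_coord /= mxE unlift_none.
Qed.

Lemma measurable_rV_uncons : measurable_fun setT rV_uncons.
Proof.
apply/measurable_fun_pair; first exact: (measurable_rV_coord ord0).
apply: measurable_fun_rVP => j.
rewrite (_ : _ \o _ = rV_coord (lift ord0 j)); first exact: measurable_rV_coord.
by apply/funext => x; rewrite /rV_coord /= mxE.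
Qed.

Variable m : {sigma_finite_measure set 'rV[R]_n -> \bar R}.

Definition borel_step : set 'rV[R]_n.+1 -> \bar R :=
  pushforward (@lebesgue_measure R \x m)%E rV_cons.

Let borel_step0 : borel_step set0 = 0%E.
Proof. by rewrite /borel_step /pushforward preimage_set0 measure0. Qed.

Let borel_step_ge0 A : (0 <= borel_step A)%E.
Proof. exact: (measure_ge0 (@lebesgue_measure R \x m)%E). Qed.

Let borel_step_additive : semi_sigma_additive borel_step.
Proof.
move=> F mF tF mUF; rewrite /borel_step /pushforward preimage_bigcup.
apply: measure_semi_sigma_additive.
- by move=> k; rewrite -[X in measurable X]setTI; exact: measurable_rV_cons.
- apply/trivIsetP => /= i j _ _ ij; rewrite -preimage_setI.
  by move/trivIsetP : tF => /(_ _ _ _ _ ij) ->//; rewrite preimage_set0.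
- rewrite -preimage_bigcup -[X in measurable X]setTI.
  exact: measurable_rV_cons.
Qed.

HB.instance Definition _ := isMeasure.Build _ _ _ borel_step
  borel_step0 borel_step_ge0 borel_step_additive.

Let borel_step_sigma_finite : sigma_finite setT borel_step.
Proof.
have /sigma_finiteP[F [TF ndF Foo]] := sigma_finiteT (@lebesgue_measure R).
have /sigma_finiteP[G [TG ndG Goo]] := sigma_finiteT m.
exists (fun k => rV_uncons @^-1` (F k `*` G k)) => [|k].
  rewrite -preimage_bigcup; apply/esym/seteqP; split=> // x _.
  have : setT (rV_uncons x).1 by [].
  have : setT (rV_uncons x).2 by [].
  rewrite TF TG => -[j _ Gj] [i _ Fi].
  exists (maxn i j) => //; split.
  - by move: Fi; exact/subsetPset/ndF/leq_maxl.
  - by move: Gj; exact/subsetPset/ndG/leq_maxr.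
have [[mF Fk] [mG Gk]] := (Foo k, Goo k); split.
  rewrite -[X in measurable X]setTI; apply: measurable_rV_uncons => //.
  exact: measurableX.
rewrite /borel_step /pushforward -comp_preimage.
have -> : rV_uncons \o rV_cons = id by apply/funext => z /=; rewrite rV_consK.
by rewrite preimage_id product_measure1E// lte_mul_pinfty// ge0_fin_numE.
Qed.

HB.instance Definition _ :=
  @Measure_isSigmaFinite.Build _ _ _ borel_step borel_step_sigma_finite.

End borel_measure_step.

(* Lebesgue measure on the Borel sets of R^n, as an iterated product. *)
Fixpoint borel_lebesgue (R : realType) (n : nat) :
    {sigma_finite_measure set 'rV[R]_n -> \bar R} :=
  match n with
  | 0 => \d_(0 : 'rV[R]_0)
  | k.+1 => borel_step (borel_lebesgue R k)
  end.

Lemma borel_lebesgue_box (R : realType) (n : nat) (a b : 'I_n -> R) :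
  (forall i, a i <= b i) ->
  measurable [set x : 'rV[R]_n | forall i, (a i < x ord0 i <= b i)%R] /\
  (borel_lebesgue R n [set x : 'rV[R]_n | forall i, (a i < x ord0 i <= b i)%R]
   = \prod_(i < n) (b i - a i)%:E)%E.
Proof.
elim: n a b => [|n IHn] a b ab.
  rewrite (_ : [set _ | _] = setT); last by apply/seteqP; split=> // x _ [].
  by split => //=; rewrite big_ord0 diracE in_setT.
have [mB EB] := IHn _ _ (fun i => ab (lift ord0 i)).
set B := [set x | _] in mB EB.
have mI : measurable (`]a ord0, b ord0] : set (measurableTypeR R)).
  exact: measurable_itv.
set C := [set x | _].
have CE : C = rV_uncons @^-1` (`]a ord0, b ord0] `*` B).
  apply/seteqP; split => x /=.
    by move=> xC; split => [|i] /=; rewrite ?mxE ?in_itv /=; apply: xC.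
  rewrite in_itv /= => -[x0 xB] i.
  by case: (unliftP ord0 i) => [j ->|-> //]; have := xB j; rewrite mxE.
split.
  rewrite CE -[X in measurable X]setTI.
  by apply: measurable_rV_uncons => //; exact: measurableX.
rewrite /= /borel_step /pushforward CE -comp_preimage.
have -> : rV_uncons \o rV_cons = id :> (_ -> (measurableTypeR R * 'rV[R]_n)%type).
  by apply/funext => z /=; rewrite rV_consK.
rewrite preimage_id product_measure1E// big_ord_recl; congr (_ * _)%E => //.
apply: (etrans (lebesgue_measure_itv `]a ord0, b ord0])) => /=.
rewrite lte_fin; case: ltgtP (ab ord0) => // -> _.
by rewrite subrr.
Qed.

(* R^n with its Lebesgue-measurable sets, and Lebesgue measure on it: the
   completion of [borel_lebesgue].  [Rn R n] unfolds to ['rV[R]_n]. *)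
Definition Rn (R : realType) (n : nat) : Type :=
  caratheodory_type (borel_lebesgue R n)^*%mu.

Definition lebesgue_rV {R : realType} {n : nat} :
    {measure set (Rn R n) -> \bar R} :=
  @completed_measure_extension _ _ _ (borel_lebesgue R n).

Lemma lebesgue_rV_box (R : realType) (n : nat) (a b : 'I_n -> R) :
  (forall i, a i <= b i) ->
  (lebesgue_rV [set x : 'rV[R]_n | forall i, (a i < x ord0 i <= b i)%R]
   = \prod_(i < n) (b i - a i)%:E)%E.
Proof.
move=> /borel_lebesgue_box[mB <-]; exact: measurable_mu_extE.
Qed.

Section weights.
Context {R : realType} {n : nat}.
Local Open Scope ereal_scope.
Local Notation mu := (@lebesgue_rV R n).
Implicit Types (f w : 'rV[R]_n -> \bar R) (x y : 'rV[R]_n) (r : R).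

(* The library norm on ['rV[R]_n] is the sup norm. *)
Definition euclidean_norm x : R := Num.sqrt (\sum_(i < n) x ord0 i ^+ 2)%R.

Definition eball x r : set 'rV[R]_n := [set y | (euclidean_norm (x - y) < r)%R].

Definition locally_integrable_rV f :=
  measurable_fun [set: Rn R n] (f : Rn R n -> \bar R) /\
  (forall K : set 'rV[R]_n, compact K -> \int[mu]_(x in K) `|f x| < +oo).

Definition is_weight w :=
  locally_integrable_rV w /\ {ae mu, forall x, 0 < w x < +oo}.

(* The quantity bounded by C in the definition of the class, for the ball
   B(x0, r); [dt] stands for \tilde\delta throughout. *)
Definition Hquantity (delta : R) {m : nat} (p : 'I_m -> \bar R)
    (b : 'I_m -> R) (dt : R) (w : 'rV[R]_n -> \bar R)
    (v : 'I_m -> 'rV[R]_n -> \bar R) (x0 : 'rV[R]_n) (r : R) : \bar R :=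
  let B := eball x0 r in
  mu B `^ (1 + (delta - dt) / n%:R) / (\int[mu]_(x in B) (w x)^-1) *
  \prod_(i < m) Lnorm mu (hoelder_conjugate (p i)) (fun x =>
    (v i x)^-1 / (mu B `^ n%:R^-1 + (euclidean_norm (x0 - x))%:E)
                   `^ (n%:R - b i + delta / m%:R)).

Definition Hclass2 (delta : R) {m : nat} (p : 'I_m -> \bar R) (beta dt : R)
    (w : 'rV[R]_n -> \bar R) (v : 'I_m -> 'rV[R]_n -> \bar R) : Prop :=
  [/\ is_weight w, forall i, is_weight (v i),
      locally_integrable_rV (fun x => (w x)^-1) &
  exists b : 'I_m -> R,
  [/\ forall i, (0 < b i < n%:R)%R, (\sum_(i < m) b i)%R = beta &
  exists2 C : R, (0 < C)%R &
    forall (x0 : 'rV[R]_n) (r : R), (0 < r)%R ->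
      Hquantity delta p b dt w v x0 r <= C%:E]].

Definition Hclass (delta : R) {m : nat} (p : 'I_m -> \bar R) (beta dt : R)
    (v : 'I_m -> 'rV[R]_n -> \bar R) : Prop :=
  Hclass2 delta p beta dt (fun x => \prod_(i < m) v i x) v.

End weights.

Section exponents.
Context {R : realType} {m : nat}.
Local Open Scope ereal_scope.
Implicit Types p : 'I_m -> \bar R.

Definition total_exponent p : \bar R := (\sum_(i < m) (p i)^-1)^-1.

(* Defined by 1/xi = m - 1/p, which also covers p = 1/m (where xi = +oo) and
   p = +oo (where xi = 1/m); see [xi_exponentE]. *)
Definition xi_exponent p : \bar R := (m%:R%:E - (total_exponent p)^-1)^-1.

Lemma xi_exponentE p (q : R) : (0 < q)%R -> total_exponent p = q%:E ->
  xi_exponent p = total_exponent p / (m%:R%:E * total_exponent p - 1).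
Proof.
rewrite /xi_exponent => q0 ->.
have qn0 := lt0r_neq0 q0.
have E : (m%:R - q^-1 = q^-1 * (m%:R * q - 1))%R.
  by rewrite mulrBr mulr1 mulrCA mulVf// mulr1.
rewrite inver (negbTE qn0) -EFinM -!EFinB E !inver mulf_eq0 invr_eq0 (negbTE qn0).
case: eqP => c0 /=; first by rewrite gt0_muley ?lte_fin.
by rewrite -EFinM invfM invrK.
Qed.

End exponents.

(* Main.v *)
Require Import Defs.
From HB Require Import structures.
From mathcomp Require Import all_boot all_order all_algebra.
From mathcomp Require Import all_classical all_reals all_analysis.
From mathcomp Require Import measurable_realfun ess_sup_inf ring lra.

Set Implicit Arguments.
Unset Strict Implicit.
Unset Printing Implicit Defensive.
Import Order.TTheory GRing.Theory Num.Theory.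
Import numFieldNormedType.Exports.

Local Open Scope classical_set_scope.
Local Open Scope ring_scope.

(** Only the local part of the condition is needed.  Fix the centre at the
origin, let B be the ball of radius r, M its measure and t = M^(1/n), and
write th_i for the reciprocal of the conjugate exponent of p_i, so that
sum_i th_i = m - 1/p = 1/xi <= 1.  Let g_i be the function whose norm
appears in the i-th factor of the condition, namely v_i^-1 divided by
(t + |x|)^gamma_i with gamma_i = n - b_i + delta/m.

On B one has t <= t + |x| <= (1 + n) t, because the radius is at most n t
([lebesgue_eball0]).  Hence w^-1 = prod_i v_i^-1 is almost everywhere on B at
most a constant times t^(sum_i gamma_i) prod_i |g_i|, and the generalized
Hoelder inequality [integral_prod_le_Lnorm] bounds the integral of w^-1 over B
by a constant times t^(sum_i gamma_i) M^(1 - sum_i th_i) prod_i ||g_i||.  The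
norms are positive since the weights are almost everywhere finite, and the
condition then forces them to be finite.  Inserting this bound into the
condition and cancelling prod_i ||g_i|| leaves
M^((beta - dt)/n + sum_i th_i - m) <= K for a constant K that does not depend
on r ([Hquantity_eball0]).

Since M lies between (r/n)^n and (2r)^n, it takes arbitrarily large and
arbitrarily small values, so the exponent vanishes ([powR_bounded_eq0]): this
is dt = beta - n/p.

The Hoelder inequality is obtained by integrating the weighted
arithmetic-geometric mean inequality [prod_powR_le]. *)


(** * The weighted arithmetic-geometric mean inequality *)

Section weighted_AM_GM.
Context {R : realType}.

Lemma powR_sum (I : Type) (s : seq I) (a : R) (th : I -> R) : 0 < a ->
  a `^ (\sum_(i <- s) th i) = \prod_(i <- s) a `^ th i.
Proof.
move=> a0; elim: s => [|i s IH]; first by rewrite !big_nil powRr0.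
by rewrite !big_cons powRD ?IH// (lt0r_neq0 a0) implybT.
Qed.

(** Tangent-line bound for the exponential, at the point x / b, raised to the
power th. *)
Lemma powR_le_expR (x b th : R) : 0 <= x -> 0 < b -> 0 <= th ->
  x `^ th <= b `^ th * expR (th * (x / b - 1)).
Proof.
move=> x0 b0 th0; rewrite mulrC [th * _]mulrC expRM.
rewrite -powRM ?expR_ge0 ?(ltW b0)//.
apply: (ge0_ler_powR th0); rewrite ?nnegrE//.
  by rewrite mulr_ge0 ?expR_ge0// ltW.
rewrite -ler_pdivrMr//; apply: le_trans (expR_ge1Dx _).
by rewrite addrC subrK.
Qed.

(** The weights may sum to less than 1; the missing weight is carried by an
extra factor equal to 1. *)
Lemma prod_powR_le (I : finType) (th x : I -> R) :
  (forall i, 0 <= th i) -> \sum_i th i <= 1 -> (forall i, 0 <= x i) ->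
  \prod_i x i `^ th i <= 1 - \sum_i th i + \sum_i th i * x i.
Proof.
move=> th0 th1 x0; set S := \sum_i th i; set X := \sum_i th i * x i.
(* the slack e makes the normalizing constant b positive *)
apply/ler_addgt0Pr => e e0; set b := _ + e.
have S1 : 0 <= 1 - S by rewrite subr_ge0.
have X0 : 0 <= X by apply: sumr_ge0 => i _; rewrite mulr_ge0.
have b0 : 0 < b by rewrite /b; lra.
apply: (@le_trans _ _ (\prod_i (b `^ th i * expR (th i * (x i / b - 1))))).
  by apply: ler_prod => i _; rewrite powR_ge0/= powR_le_expR.
rewrite big_split/= -powR_sum// -expR_sum -/S.
have -> : \sum_i th i * (x i / b - 1) = X / b - S.
  rewrite mulr_suml -sumrB; apply: eq_bigr => i _.
  by rewrite mulrBr mulr1 mulrA.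
(* the extra factor 1, of weight 1 - S, completes the exponents of b to 1 *)
have h1 := @powR_le_expR 1 b (1 - S) ler01 b0 S1.
rewrite powR1 in h1.
apply: le_trans (ler_peMr _ h1) _; first by rewrite mulr_ge0 ?powR_ge0 ?expR_ge0.
rewrite mulrACA -powRD ?(lt0r_neq0 b0) ?implybT// -expRD.
rewrite addrC subrK powRr1 ?(ltW b0)//.
apply: ler_piMr; first exact: ltW.
rewrite expR_le1.
have -> : X / b - S + (1 - S) * (1 / b - 1) = (1 - S + X - b) / b.
  by field; rewrite gt_eqF.
by rewrite pmulr_lle0 ?invr_gt0// /b; lra.
Qed.

End weighted_AM_GM.

(** * The generalized Hoelder inequality *)

Section generalized_hoelder.
Context d {T : measurableType d} {R : realType}.
Variable mu : {measure set T -> \bar R}.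
Local Open Scope ereal_scope.

Lemma emeasurable_prod (I : Type) (s : seq I) (D : set T)
    (h : I -> T -> \bar R) :
  (forall i, measurable_fun D (h i)) ->
  measurable_fun D (fun x => \prod_(i <- s) h i x).
Proof.
move=> mh; elim: s => [|i s IH].
  by under eq_fun do rewrite big_nil; exact: measurable_cst.
by under eq_fun do rewrite big_cons; exact: emeasurable_funM.
Qed.

Lemma inve_fin_ge1 (q : \bar R) (th : R) : 1 <= q -> q^-1 = th%:E ->
  (q = +oo /\ th = 0%R) \/ (q = (th^-1)%:E /\ (0 < th)%R).
Proof.
case: q => [r| |]//.
  rewrite lee_fin => r1; have r0 : (0 < r)%R by apply: lt_le_trans r1.
  rewrite inver (gt_eqF r0) => -[<-]; right.
  by rewrite invrK invr_gt0.
by rewrite invey => _ [<-]; left.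
Qed.

Lemma Lnorm_pinfty_ae (g : T -> \bar R) (y : \bar R) : 0 < mu setT ->
  Lnorm mu +oo g <= y -> {ae mu, forall x, `|g x| <= y}.
Proof. by rewrite unlock => -> /ess_supP. Qed.

Lemma integral_poweR_le_Lnorm (D : set T) (g : T -> \bar R) (r N : R) :
  measurable D -> measurable_fun setT g -> (0 < r)%R -> (0 <= N)%R ->
  Lnorm mu r%:E g <= N%:E ->
  \int[mu]_(x in D) (`|g x| `^ r) <= (N `^ r)%:E.
Proof.
move=> mD mg r0 N0 gN.
apply: (@le_trans _ _ (\int[mu]_x (`|g x| `^ r))).
  apply: ge0_subset_integral => //.
    apply: (@measurableT_comp _ _ _ _ _ _ (fun y => y `^ r)) => //=.
      exact: measurable_poweR.
    exact: measurableT_comp.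
  by move=> x _; exact: poweR_ge0.
rewrite -powR_Lnorm ?gt_eqF// -poweR_EFin.
by apply: gt0_ler_poweR; rewrite ?in_itv/= ?leey ?andbT ?Lnorm_ge0 ?lee_fin// ltW.
Qed.

(** Pointwise form of the Hoelder inequality on a set of measure M.  Here th i is
the reciprocal of the i-th exponent and a i the value of the i-th function.  An
index with th i = 0 stands for the exponent +oo: its term vanishes in the sum
on the right, and the function is bounded by N i instead. *)
Lemma prod_abse_le (I : finType) (a : I -> \bar R) (th N : I -> R) (M : R) :
  (0 < M)%R -> (forall i, 0 <= th i)%R -> (\sum_i th i <= 1)%R ->
  (forall i, 0 < N i)%R -> (forall i, 0 <= a i) ->
  (forall i, th i = 0%R -> a i <= (N i)%:E) ->
  \prod_i a i <= (M `^ (- \sum_i th i) * \prod_i N i)%:E *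
    ((1 - \sum_i th i)%:E + M%:E *
      \sum_i (th i * (N i `^ (th i)^-1)^-1)%:E * a i `^ (th i)^-1).
Proof.
move=> M0 th0 th1 N0 a0 aN.
have PN0 : (0 < \prod_i N i)%R by apply: prodr_gt0.
have MS0 : (0 < M `^ (- \sum_i th i))%R by exact: powR_gt0.
have c0 i : (0 <= th i * (N i `^ (th i)^-1)^-1)%R.
  by rewrite mulr_ge0// invr_ge0 powR_ge0.
(* an infinite value on the left makes the right-hand side infinite too *)
have [[i ai]|afin] := pselect (exists i, a i = +oo).
  rewrite (_ : _ + _ = +oo); first by rewrite gt0_muley ?leey// lte_fin mulr_gt0.
  suff -> : \sum_i (th i * (N i `^ (th i)^-1)^-1)%:E * a i `^ (th i)^-1 = +oo.
    by rewrite gt0_muley ?lte_fin// addey.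
  have thi : (0 < th i)%R.
    rewrite lt_neqAle th0 andbT; apply/eqP => thi.
    by have := aN i (esym thi); rewrite ai.
  apply/eqP; rewrite esum_eqy; last first.
    move=> j _; rewrite gt_eqF//; apply: (lt_le_trans ltNy0).
    by rewrite mule_ge0 ?lee_fin ?poweR_ge0.
  apply/existsP; exists i; rewrite /= ai poweRyr ?invr_neq0 ?(lt0r_neq0 thi)//.
  by rewrite gt0_muley// lte_fin mulr_gt0// invr_gt0 powR_gt0.
have {afin} aE i : a i = (fine (a i))%:E.
  rewrite fineK// ge0_fin_numE// ltey; apply/eqP => ai.
  by apply: afin; exists i.
have fa0 i : (0 <= fine (a i))%R by rewrite fine_ge0.
rewrite (eq_bigr (fun i => (fine (a i))%:E)); last by move=> i _; exact: aE.
rewrite [X in _ + _ * X](eq_bigr (fun i =>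
    (th i * (fine (a i) / N i) `^ (th i)^-1)%:E)); last first.
  move=> i _; rewrite {1}aE poweR_EFin -EFinM -mulrA; congr (_ * _)%:E.
  by rewrite mulrC powRM ?invr_ge0 ?(ltW (N0 i))// -(powR_inv1 (ltW (N0 i)))
     -powRrM mulN1r powRN.
rewrite prodEFin sumEFin -!EFinM lee_fin.
(* the inequality of means for the numbers M (a_i / N_i)^(1 / th_i) *)
have AG := @prod_powR_le R I th
  (fun i => M * (fine (a i) / N i) `^ (th i)^-1)%R th0 th1.
have x0 i : (0 <= M * (fine (a i) / N i) `^ (th i)^-1)%R.
  by rewrite mulr_ge0 ?powR_ge0// ltW.
move: AG => /(_ x0) AG.
rewrite powRN -mulrA ler_pdivlMl ?powR_gt0// mulrC [leRHS]mulrC.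
rewrite -ler_pdivrMr// mulrAC mulrC mulr_sumr.
rewrite [X in (_ + X)%R](eq_bigr (fun i =>
    th i * (M * (fine (a i) / N i) `^ (th i)^-1))%R);
  last by move=> i _; rewrite mulrCA.
apply: le_trans AG.
rewrite powR_sum// -prodfV -!big_split/=.
apply: ler_prod => i _; apply/andP; split.
  by rewrite !mulr_ge0 ?powR_ge0// invr_ge0 ltW.
rewrite powRM ?(ltW M0) ?powR_ge0//.
apply: ler_wpM2l; first exact: powR_ge0.
have [thi|thi] := eqVneq (th i) 0%R.
  rewrite thi powRr0 ler_pdivrMr// mul1r -lee_fin -aE.
  exact: aN.
by rewrite -powRrM mulVf// powRr1// mulr_ge0// invr_ge0 ltW.
Qed.

(** The norms are taken over the whole space, while the product is integrated
over a set D of finite measure M; the defect 1 - sum_i th i of the exponents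
turns into a power of M.  Bounding the norms by positive reals N i avoids
products of the form 0 * +oo. *)
Lemma integral_prod_le_Lnorm (I : finType) (D : set T)
    (g : I -> T -> \bar R) (q : I -> \bar R) (th N : I -> R) (M : R) :
  measurable D -> mu D = M%:E -> (0 < M)%R ->
  (forall i, measurable_fun setT (g i)) ->
  (forall i, 1 <= q i) -> (forall i, (q i)^-1 = (th i)%:E) ->
  (\sum_i th i <= 1)%R ->
  (forall i, 0 < N i)%R -> (forall i, Lnorm mu (q i) (g i) <= (N i)%:E) ->
  \int[mu]_(x in D) \prod_i `|g i x| <=
    (M `^ (1 - \sum_i th i) * \prod_i N i)%:E.
Proof.
move=> mD muD M0 mg q1 qth th1 N0 gN.
have muT0 : 0 < mu setT.
  by apply: (@lt_le_trans _ _ (mu D)); rewrite ?muD ?lte_fin// -muD le_measure ?inE.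
have qP i := inve_fin_ge1 (q1 i) (qth i).
have th0 i : (0 <= th i)%R by case: (qP i) => -[_]; [move=> ->|move/ltW].
have PN0 : (0 < \prod_i N i)%R by apply: prodr_gt0.
set S := (\sum_i th i)%R.
have S1 : (0 <= 1 - S)%R by rewrite subr_ge0.
have k0 : (0 <= M `^ (- S) * \prod_i N i)%R by rewrite mulr_ge0 ?powR_ge0 ?ltW.
(* h i has integral at most th i over D; it is zero when th i = 0 *)
pose h i x := (th i * (N i `^ (th i)^-1)^-1)%:E * `|g i x| `^ (th i)^-1.
have c0 i : (0 <= th i * (N i `^ (th i)^-1)^-1)%R.
  by rewrite mulr_ge0// invr_ge0 powR_ge0.
have h0 i x : 0 <= h i x by rewrite mule_ge0 ?lee_fin ?poweR_ge0.
have mp i : measurable_fun setT (fun x => `|g i x| `^ (th i)^-1).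
  apply: (@measurableT_comp _ _ _ _ _ _ (fun y => y `^ (th i)^-1)) => //=.
    exact: measurable_poweR.
  exact: measurableT_comp.
have mh i : measurable_fun D (h i).
  by apply: measurable_funeM; apply: measurable_funTS.
have ih i : \int[mu]_(x in D) h i x <= (th i)%:E.
  rewrite /h ge0_integralZl ?lee_fin//; last 2 first.
  - exact: measurable_funTS.
  - by move=> x _; exact: poweR_ge0.
  case: (qP i) => [[_ ->]|[qi thi]]; first by rewrite mul0r mul0e.
  have := gN i; rewrite qi.
  move=> /(integral_poweR_le_Lnorm mD (mg i)); rewrite invr_gt0.
  move=> /(_ thi (ltW (N0 i))) iN.
  apply: le_trans (lee_wpmul2l _ iN) _; first by rewrite lee_fin.
  by rewrite -EFinM mulfVK// gt_eqF// powR_gt0.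
have mH : measurable_fun D (fun x => \sum_i h i x) by exact: emeasurable_sum.
have mMH : measurable_fun D (fun x => M%:E * \sum_i h i x).
  exact: measurable_funeM.
have H0 x : 0 <= \sum_i h i x by apply: sume_ge0.
have MH0 x : 0 <= M%:E * \sum_i h i x by rewrite mule_ge0 ?lee_fin ?(ltW M0).
have mSH : measurable_fun D (fun x => (1 - S)%:E + M%:E * \sum_i h i x).
  by apply: emeasurable_funD.
have SH0 x : 0 <= (1 - S)%:E + M%:E * \sum_i h i x by rewrite adde_ge0 ?lee_fin.
apply: (@le_trans _ _ (\int[mu]_(x in D) ((M `^ (- S) * \prod_i N i)%:E *
    ((1 - S)%:E + M%:E * \sum_i h i x)))).
  apply: ae_ge0_le_integral => //.
  - by move=> x _; apply: prode_ge0.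
  - apply: emeasurable_prod => i; apply: measurable_funTS.
    exact: measurableT_comp.
  - by move=> x _; rewrite mule_ge0 ?lee_fin.
  - exact: measurable_funeM.
  have : {ae mu, forall x, forall i, th i = 0%R -> `|g i x| <= (N i)%:E}.
    have H i : {ae mu, forall x, th i = 0%R -> `|g i x| <= (N i)%:E}.
      case: (qP i) => [[qi _]|[_ thi]]; last first.
        by apply: nearW => x thi0; move: thi; rewrite thi0 ltxx.
      have := gN i; rewrite qi => /(Lnorm_pinfty_ae muT0).
      by apply: filterS => x + _.
    pose P i : set T := [set x | th i = 0%R -> `|g i x| <= (N i)%:E].
    exact: (@filter_forall T I P (almost_everywhere mu) _ H).
  apply: filterS => x gx _.
  by apply: prod_abse_le.
rewrite ge0_integralZl ?lee_fin//.
rewrite ge0_integralD//.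
rewrite integral_cst// ge0_integralZl ?lee_fin// ?(ltW M0)//.
rewrite ge0_integral_sum//.
apply: (@le_trans _ _ ((M `^ (- S) * \prod_i N i)%:E *
    ((1 - S)%:E * mu D + M%:E * \sum_i (th i)%:E))).
  apply: lee_wpmul2l; first by rewrite lee_fin.
  apply: leeD => //; apply: lee_wpmul2l; first by rewrite lee_fin ltW.
  by apply: lee_sum.
rewrite muD sumEFin -!EFinM lee_fin.
rewrite -/S (mulrC M) -mulrDl subrK mul1r mulrAC.
by rewrite addrC powRD ?(lt0r_neq0 M0) ?implybT// powRr1// ltW.
Qed.

End generalized_hoelder.

(** * Euclidean balls and Lebesgue measure *)

Section euclidean_balls.
Context {R : realType} {n : nat}.
Local Notation mu := (@lebesgue_rV R n).

(** Borel sets are Lebesgue measurable. *)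
Lemma measurable_Rn (A : set 'rV[R]_n) :
  measurable A -> measurable (A : set (Rn R n)).
Proof. exact: caratheodory_measurable_mu_ext. Qed.

Lemma measurable_fun_Rn d' (U : measurableType d') (f : 'rV[R]_n -> U) :
  measurable_fun [set: 'rV[R]_n] f -> measurable_fun [set: Rn R n] (f : Rn R n -> U).
Proof.
by move=> mf _ Y mY; apply: measurable_Rn; exact: mf.
Qed.

Lemma euclidean_norm_ge0 (x : 'rV[R]_n) : 0 <= euclidean_norm x.
Proof. exact: sqrtr_ge0. Qed.

Lemma measurable_euclidean_normB (x0 : 'rV[R]_n) :
  measurable_fun [set: 'rV[R]_n] (fun x => euclidean_norm (x0 - x)).
Proof.
apply: (@measurableT_comp _ _ _ _ _ _ (@Num.sqrt R)) => //=.
  by apply: continuous_measurable_fun; exact: sqrt_continuous.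
apply: measurable_sum => i.
apply: measurable_funX.
rewrite (_ : (fun _ => _) = (fun x => x0 ord0 i - rV_coord i x)); last first.
  by apply/funext => x; rewrite !mxE.
apply: measurable_funB => //.
exact: measurable_rV_coord.
Qed.

Lemma measurable_eball (x0 : 'rV[R]_n) (r : R) :
  measurable (eball x0 r : set 'rV[R]_n).
Proof.
have := @measurable_euclidean_normB x0 measurableT _ (measurable_itv `]-oo, r[).
by rewrite setTI; congr measurable.
Qed.

Lemma le_coord_euclidean_norm (x : 'rV[R]_n) i : `|x ord0 i| <= euclidean_norm x.
Proof.
rewrite -sqrtr_sqr ler_wsqrtr// (bigD1 i)//= lerDl.
by apply: sumr_ge0 => j _; rewrite sqr_ge0.
Qed.

Lemma euclidean_norm_le (x : 'rV[R]_n) (a : R) : 0 <= a ->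
  (forall i, `|x ord0 i| <= a) -> euclidean_norm x <= n%:R * a.
Proof.
move=> a0 xa.
rewrite -[leRHS]ger0_norm ?mulr_ge0// -sqrtr_sqr ler_wsqrtr//.
apply: (@le_trans _ _ (\sum_(i < n) a ^+ 2)).
  apply: ler_sum => i _; rewrite -real_normK ?num_real//.
  by rewrite lerXn2r ?nnegrE.
rewrite sumr_const card_ord -[leLHS]mulr_natl exprMn ler_wpM2r ?sqr_ge0//.
by rewrite -natrX ler_nat; case: (n) => // k; rewrite -[leqLHS]muln1 leq_mul.
Qed.

(** The closed cube of half-side [a] centred at the origin, that is, the closed
ball of the sup norm. *)
Definition cube (a : R) : set 'rV[R]_n :=
  [set x | forall i, - a <= x ord0 i <= a].

Lemma compact_cube a : compact (cube a).
Proof.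
rewrite (_ : cube a = [set x : 'rV[R]_n | forall i, `[- a, a]%classic (x ord0 i)]).
  by apply: (@rV_compact R n (fun=> `[- a, a]%classic)) => i; exact: segment_compact.
by apply/seteqP; split => x /= h i; have := h i; rewrite in_itv.
Qed.

Lemma measurable_cube a : measurable (cube a).
Proof.
rewrite (_ : cube a = \bigcap_(i in [set: 'I_n]) (rV_coord i @^-1` `[- a, a])).
  apply: fin_bigcap_measurable => // i _.
  by rewrite -[X in measurable X]setTI; exact: measurable_rV_coord.
apply/seteqP; split => x /= h i; first by move=> _; rewrite /= in_itv; exact: h.
by have := h i Logic.I; rewrite /= in_itv.
Qed.

Lemma eball0_sub_cube r : eball 0 r `<=` cube r.
Proof.
move=> x; rewrite /eball/= sub0r => xr i.
have := le_lt_trans (le_coord_euclidean_norm (- x) i) xr.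
by rewrite mxE normrN -ler_norml => /ltW.
Qed.

(** Comparison with the half-open cubes of half-side r and r / (2 n).  The
constants are not sharp; only the order of magnitude in r matters. *)
Lemma lebesgue_eball0 (r : R) : (0 < n)%N -> 0 < r ->
  exists M : R, [/\ mu (eball 0 r) = M%:E, (r / n%:R) ^+ n <= M & M <= (2 * r) ^+ n].
Proof.
move=> n0 r0.
have mB := measurable_Rn (measurable_eball 0 r).
pose box (a : R) := [set x : 'rV[R]_n | forall i, - a < x ord0 i <= a].
have boxE a : 0 <= a -> mu (box a) = ((2 * a) ^+ n)%:E.
  move=> a0; rewrite /box (@lebesgue_rV_box _ _ (fun=> - a) (fun=> a)).
    by rewrite prodEFin prodr_const card_ord; congr ((_ ^+ _)%:E); lra.
  by move=> _; lra.
have mbox a : 0 <= a -> measurable (box a : set (Rn R n)).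
  move=> a0; apply: measurable_Rn.
  have aa : - a <= a by lra.
  by have [] := @borel_lebesgue_box R n (fun=> - a) (fun=> a) (fun=> aa).
have n0' : (0 : R) < n%:R by rewrite ltr0n.
have ub : (mu (eball 0 r) <= ((2 * r) ^+ n)%:E)%E.
  rewrite -(boxE _ (ltW r0)); apply: le_measure; rewrite ?inE//.
    exact/mbox/ltW.
  move=> x; rewrite /eball/= sub0r => xr i.
  have := le_lt_trans (le_coord_euclidean_norm (- x) i) xr.
  by rewrite mxE normrN ltr_norml => /andP[-> /ltW].
have lb : (((r / n%:R) ^+ n)%:E <= mu (eball 0 r))%E.
  pose a := r / n%:R / 2.
  have a0 : 0 < a by rewrite !divr_gt0.
  rewrite (_ : r / n%:R = 2 * a); last by rewrite /a; field; rewrite gt_eqF.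
  rewrite -(boxE _ (ltW a0)); apply: le_measure; rewrite ?inE//.
    exact/mbox/ltW.
  move=> x xa; rewrite /eball/= sub0r.
  apply: (@le_lt_trans _ _ (n%:R * a)).
    apply: euclidean_norm_le => [|i]; first exact: ltW.
    by rewrite mxE normrN ler_norml; have /andP[/ltW -> ->] := xa i.
  by rewrite /a mulrA mulrCA divff ?gt_eqF// mulr1 ltr_pdivrMr//; lra.
have fB : mu (eball 0 r) \is a fin_num.
  by rewrite ge0_fin_numE// (le_lt_trans ub)// ltry.
exists (fine (mu (eball 0 r))).
by rewrite fineK// -!lee_fin fineK.
Qed.

End euclidean_balls.

(** * Powers and extended reals *)

Section auxiliary_facts.
Context {R : realType}.

(** The sign of the exponent g is arbitrary, whence its absolute value on the
right. *)
Lemma powRD_le (t s k g : R) : 0 < t -> 0 <= s <= k * t ->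
  (t + s) `^ g <= (1 + k) `^ `|g| * t `^ g.
Proof.
move=> t0 /andP[s0 sk].
have u1 : 1 <= 1 + s / t by rewrite lerDl divr_ge0// ltW.
have uk : 1 + s / t <= 1 + k by rewrite lerD2l ler_pdivrMr.
have u0 : 0 <= 1 + s / t by apply: le_trans u1.
have -> : t + s = (1 + s / t) * t by rewrite mulrDl mul1r divfK// gt_eqF.
rewrite powRM ?(ltW t0)//; apply: ler_wpM2r; first exact: powR_ge0.
apply: (@le_trans _ _ ((1 + s / t) `^ `|g|)).
  by apply: ler_powR => //; exact: ler_norm.
by apply: ge0_ler_powR => //; rewrite nnegrE (le_trans u0).
Qed.

Lemma measurable_invr : measurable_fun [set: R] (@GRing.inv R).
Proof.
(* the power is only well behaved on nonnegative reals, whence the square *)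
rewrite (_ : @GRing.inv R = fun x => x * (x ^+ 2) `^ (-1)).
  apply: measurable_funM => //.
  apply: (@measurableT_comp _ _ _ _ _ _ (@powR R ^~ (-1))).
    exact: measurable_powR.
  exact: measurable_funX.
apply/funext => x; rewrite powR_inv1 ?sqr_ge0//.
have [->|x0] := eqVneq x 0; first by rewrite invr0 mul0r.
by rewrite expr2 invfM mulrA divff// mul1r.
Qed.

(** A power that stays bounded along both arbitrarily large and arbitrarily small
arguments has exponent zero. *)
Lemma powR_bounded_eq0 (e C : R) :
  (forall l : R, 0 < l -> exists2 M, l <= M & M `^ e <= C) ->
  (forall l : R, 0 < l -> exists2 M, 0 < M <= l & M `^ e <= C) -> e = 0.
Proof.
move=> Hbig Hsmall; apply/eqP; apply: contraT => e0.
have [M1 M10 C0] := Hbig 1 ltr01.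
have {}C0 : 0 <= C by apply: le_trans C0; exact: powR_ge0.
have C1 : 0 < C + 1 by rewrite ltr_wpDl.
(* l is the argument at which the power equals C + 1 *)
pose l := (C + 1) `^ e^-1.
have l0 : 0 < l by exact: powR_gt0.
have lE : l `^ e = C + 1 by rewrite -powRrM mulVf// powRr1// ltW.
suff [M lM MC] : exists2 M, l `^ e <= M `^ e & M `^ e <= C.
  by move: (le_trans lM MC); rewrite lE gerDl ler10.
case: (ltgtP e 0) e0 => // e0 _.
- have [M /andP[M0 Ml] MC] := Hsmall l l0; exists M => //.
  rewrite -[e]opprK [leLHS]powRN [leRHS]powRN lef_pV2 ?posrE ?powR_gt0//.
  by apply: ge0_ler_powR; rewrite ?nnegrE ?oppr_ge0// ltW.
- have [M lM MC] := Hbig l l0; exists M => //.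
  by apply: ge0_ler_powR; rewrite ?nnegrE ?(ltW e0) ?(ltW l0)// (le_trans (ltW l0)).
Qed.

Local Open Scope ereal_scope.

Lemma inve_prod (I : finType) (a : I -> \bar R) :
  (forall i, 0 < a i < +oo) -> (\prod_i a i)^-1 = \prod_i (a i)^-1.
Proof.
move=> aP.
pose r i : R := fine (a i).
have aE i : a i = (r i)%:E.
  by have /andP[a0 ay] := aP i; rewrite fineK// ge0_fin_numE// ltW.
have r0 i : (r i != 0)%R.
  by apply: lt0r_neq0; rewrite -lte_fin -aE; have /andP[] := aP i.
rewrite (eq_bigr (fun i => (r i)%:E)); last by move=> i _; exact: aE.
rewrite [RHS](eq_bigr (fun i => ((r i)^-1)%:E)); last first.
  by move=> i _; rewrite aE inver (negbTE (r0 i)).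
rewrite !prodEFin inver prodfV; case: ifPn => // /eqP/eqP.
by rewrite prodf_seq_eq0 => /hasP[i _ /=]; rewrite (negbTE (r0 i)).
Qed.

Lemma lee_prod (I : finType) (f g : I -> \bar R) :
  (forall i, 0 <= f i <= g i) -> \prod_i f i <= \prod_i g i.
Proof.
move=> fg; suff /andP[] : 0 <= \prod_i f i <= \prod_i g i by [].
elim/big_ind2: _ => [|x1 x2 y1 y2 /andP[x0 x12] /andP[y0 y12]|i _].
- by rewrite lee01 lexx.
- by rewrite mule_ge0//= lee_pmul.
- exact: fg.
Qed.

Lemma prode_gt0 (I : finType) (P : pred I) (a : I -> \bar R) :
  (forall i, 0 < a i) -> 0 < \prod_(i | P i) a i.
Proof. by move=> a0; elim/big_rec: _ => // i x _ x0; exact: mule_gt0. Qed.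

Lemma prode_fin_num_factor (I : finType) (a : I -> \bar R) :
  (forall i, 0 < a i) -> \prod_i a i < +oo -> forall i, a i \is a fin_num.
Proof.
move=> a0 + i; rewrite ge0_fin_numE ?(ltW (a0 i))// (bigD1 i)//=.
move=> ay; rewrite ltey; apply/eqP => aiy; move: ay.
by rewrite aiy gt0_mulye ?ltxx// prode_gt0.
Qed.

(** The case W = 0 is excluded, because then the left-hand side of the hypothesis
is infinite. *)
Lemma divM_le_fin (a C : R) (W P : \bar R) : (0 < a)%R -> 0 <= W < +oo ->
  0 < P -> a%:E / W * P <= C%:E -> P < +oo /\ a%:E * P <= C%:E * W.
Proof.
move=> a0 /andP[]; case: W => [W| |]// W0 _ P0.
have [->|Wn0] := eqVneq W 0%R.
  by rewrite inve0 gt0_muley ?lte_fin// gt0_mulye.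
have {Wn0}W0 : (0 < W)%R by rewrite lt_neqAle eq_sym Wn0.
rewrite inver gt_eqF//.
case: P P0 => [P| |]// P0; last first.
  by rewrite gt0_muley // lte_fin mulr_gt0// invr_gt0.
rewrite -!EFinM !lee_fin => h; split; first exact: ltry.
by rewrite -ler_pdivrMr// mulrAC.
Qed.

Lemma measurable_inve : measurable_fun [set: \bar R] (@inve R).
Proof.
rewrite (_ : @inve R = fun x : \bar R => if x == 0 then +oo else
    if x == -oo then -oo else ((fine x)^-1)%:E); last first.
  apply/funext => -[r| |]; first by rewrite inver eqe.
    by rewrite invey/= invr0.
  by rewrite inveNy.
apply: measurable_fun_ifT => //=; first exact: measurable_fun_eqe.
apply: measurable_fun_ifT => //=; first exact: measurable_fun_eqe.
apply/measurable_EFinP => /=.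
exact: (measurableT_comp measurable_invr).
Qed.

End auxiliary_facts.

(** * The estimate on a ball *)

Section ball_estimate.
Context {R : realType} {n m : nat}.
Local Notation mu := (@lebesgue_rV R n).
Context (delta dt : R) (p : 'I_m -> \bar R) (b th : 'I_m -> R).
Context (v : 'I_m -> 'rV[R]_n -> \bar R).
Context (n0 : (0 < n)%N) (m0 : (0 < m)%N).
Context (p1 : forall i, (1 <= p i)%E).
Context (thE : forall i, ((hoelder_conjugate (p i))^-1)%E = (th i)%:E).
Context (th1 : \sum_i th i <= 1).
Context (wv : forall i, is_weight (v i)).
Context (wV : locally_integrable_rV (fun x => (\prod_i v i x)^-1)%E).

Local Notation w := (fun x => \prod_i v i x)%E.
Local Notation gam i := (n%:R - b i + delta / m%:R).

(** Stated for the carrier [Rn R n], which instance search does not unfold. *)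
Local Instance ae_lebesgue_filter : Filter (almost_everywhere mu).
Proof. exact: ae_filter_ringOfSetsType. Qed.

Lemma ae_weights_finite : {ae mu, forall x, forall i, (0 < v i x < +oo)%E}.
Proof.
pose P i : set (Rn R n) := [set x | (0 < v i x < +oo)%E].
apply: (@filter_forall _ _ P (almost_everywhere mu)) => i.
by have [] := wv i.
Qed.

(** The reciprocal of w may be negative on a null set, so its integral is first
replaced with that of its absolute value. *)
Lemma weight_integral_eball r : 0 < r ->
  (\int[mu]_(x in eball 0 r) (w x)^-1 = \int[mu]_(x in eball 0 r) `|(w x)^-1|
   /\ 0 <= \int[mu]_(x in eball 0 r) `|(w x)^-1| < +oo)%E.
Proof.
move=> r0; have [mw iw] := wV.
have mB := measurable_Rn (@measurable_eball R n 0 r).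
split.
  apply: ae_eq_integral.
  - exact: mB.
  - exact: measurable_funTS.
  - by apply: measurable_funTS; exact: measurableT_comp.
  move: ae_weights_finite; apply: filterS => x vx _.
  rewrite gee0_abs// inve_prod// prode_ge0// => i _.
  by rewrite inve_ge0 ltW//; have /andP[] := vx i.
apply/andP; split; first by apply: integral_ge0.
apply: le_lt_trans (iw (cube r) (@compact_cube R n r)).
apply: ge0_subset_integral.
- exact: mB.
- by apply: measurable_Rn; exact: measurable_cube.
- by apply: measurable_funTS; exact: measurableT_comp.
- by move=> x _; exact: abse_ge0.
- exact: eball0_sub_cube.
Qed.

(** The bound on the right depends on C but not on the ball.  The factor
(1 + n)^|gamma_i| comes from comparing t + |x| with t on the ball, which the
hypothesis r <= n t allows. *)
Lemma Hquantity_eball0 (r M C : R) : 0 < r -> 0 < M -> 0 < C ->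
  mu (eball 0 r) = M%:E ->
  r <= n%:R * M `^ n%:R^-1 ->
  (Hquantity delta p b dt w v 0 r <= C%:E)%E ->
  M `^ ((\sum_i b i - dt) / n%:R + \sum_i th i - m%:R) <=
    C * \prod_i (1 + n%:R) `^ `|gam i|.
Proof.
move=> r0 M0 C0 muB rM.
set t := M `^ n%:R^-1 in rM *.
have t0 : 0 < t by exact: powR_gt0.
have mB := measurable_Rn (@measurable_eball R n 0 r).
have [WE W0y] := weight_integral_eball r0.
pose den i (x : 'rV[R]_n) : R := (t + euclidean_norm (0 - x)) `^ gam i.
have y0 x : 0 < t + euclidean_norm (0 - x) by rewrite ltr_pwDl ?euclidean_norm_ge0.
have den0 i x : 0 < den i x by exact: powR_gt0.
pose g i (x : Rn R n) : \bar R := ((v i x)^-1 * ((den i x)^-1)%:E)%E.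
have mg i : measurable_fun setT (g i).
  apply: emeasurable_funM.
    by apply: measurableT_comp measurable_inve _; have [[]] := wv i.
  apply/measurable_EFinP => /=; apply: measurable_fun_Rn.
  apply: (measurableT_comp measurable_invr).
  apply: (@measurableT_comp _ _ _ _ _ _ (@powR R ^~ (gam i))).
    exact: measurable_powR.
  by apply: measurable_funD => //; exact: measurable_euclidean_normB.
rewrite /Hquantity muB WE !poweR_EFin -/t.
rewrite (eq_bigr (fun i => Lnorm mu (hoelder_conjugate (p i)) (g i))); last first.
  move=> i _; congr Lnorm; apply/funext => x.
  by rewrite -EFinD poweR_EFin inver gt_eqF// den0.
have q1 i : (1 <= hoelder_conjugate (p i))%E by exact: hoelder_conj_ge1.
have muT0 : (0 < mu setT)%E.
  apply: (@lt_le_trans _ _ (mu (eball 0 r))); first by rewrite muB lte_fin.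
  by rewrite le_measure ?inE.
pose N i : \bar R := Lnorm mu (hoelder_conjugate (p i)) (g i).
(* a vanishing norm would make v i infinite almost everywhere *)
have N0 i : (0 < N i)%E.
  rewrite lt_neqAle Lnorm_ge0 andbT; apply/eqP => /esym Ni0.
  have q0 : (0 < hoelder_conjugate (p i))%E by apply: lt_le_trans (q1 i).
  have gi0 := Lnorm_eq0_eq0 (mg i) q0 Ni0.
  have PF := ae_properfilter_algebraOfSetsType muT0.
  have : {ae mu, forall x : Rn R n, False}.
    apply: filterS2 gi0 ae_weights_finite => x /(_ Logic.I)/= gx /(_ i).
    move=> /andP[vx0 vxy]; apply/eqP: gx.
    apply: mule_neq0; first by rewrite inve_eq0 lt_eqF.
    by rewrite eqe invr_eq0 gt_eqF.
  by move=> /filter_ex[].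
move=> HC.
have [Py HW] := divM_le_fin (powR_gt0 _ M0) W0y (prode_gt0 predT N0) HC.
have Nfin := prode_fin_num_factor N0 Py.
pose F i : R := fine (N i).
have NF i : N i = (F i)%:E by rewrite /F fineK.
have F0 i : 0 < F i by rewrite -lte_fin -NF.
have PF0 : 0 < \prod_i F i by exact: prodr_gt0.
have NF' i : (Lnorm mu (hoelder_conjugate (p i)) (g i) <= (F i)%:E)%E.
  by rewrite -NF.
have Hoe := integral_prod_le_Lnorm mB muB M0 mg q1 thE th1 F0 NF'.
pose c : R := \prod_i ((1 + n%:R) `^ `|gam i| * t `^ gam i).
have c0 : 0 < c.
  by apply: prodr_gt0 => i _; rewrite mulr_gt0 ?powR_gt0// ltr_pwDl.
(* the Hoelder inequality for the g i, multiplied by the bound c on their denominators *)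
have Wle : (\int[mu]_(x in eball 0 r) `|(w x)^-1| <=
    c%:E * (M `^ (1 - \sum_i th i) * \prod_i F i)%:E)%E.
  have mgg i : measurable_fun (eball 0 r : set (Rn R n)) (fun x => `|g i x|)%E.
    by apply: measurable_funTS; exact: measurableT_comp.
  have mG : measurable_fun (eball 0 r : set (Rn R n)) (fun x => \prod_i `|g i x|)%E.
    exact: emeasurable_prod.
  apply: le_trans (lee_wpmul2l _ Hoe); last by rewrite lee_fin ltW.
  rewrite -ge0_integralZl; first last.
  - by rewrite lee_fin ltW.
  - by move=> x _; apply: prode_ge0.
  - exact: mG.
  - exact: mB.
  apply: ae_ge0_le_integral.
  - exact: mB.
  - by move=> x _; exact: abse_ge0.
  - by have [mw _] := wV; apply: measurable_funTS; exact: measurableT_comp.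
  - by move=> x _; rewrite mule_ge0 ?prode_ge0// lee_fin ltW.
  - exact: measurable_funeM.
  move: ae_weights_finite; apply: filterS => x vx Bx.
  have vV0 i : (0 <= (v i x)^-1)%E.
    by rewrite inve_ge0 ltW//; have /andP[] := vx i.
  rewrite inve_prod// gee0_abs ?prode_ge0//.
  rewrite /c -prodEFin -big_split/=; apply: lee_prod => i.
  rewrite vV0/= /g abseM (gee0_abs (vV0 i)) muleCA.
  apply: lee_pemulr => //.
  rewrite abse_EFin -EFinM lee_fin ger0_norm ?invr_ge0 ?(ltW (den0 _ _))//.
  rewrite ler_pdivlMr// mul1r; apply: powRD_le => //.
  by rewrite euclidean_norm_ge0/= (le_trans _ rM)// ltW.
have {HW Wle}Hfin : M `^ (1 + (delta - dt) / n%:R) * \prod_i F i <=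
    C * (c * (M `^ (1 - \sum_i th i) * \prod_i F i)).
  rewrite -lee_fin 2!EFinM -prodEFin.
  rewrite -(eq_bigr _ (fun i _ => NF i)).
  apply: le_trans HW _; rewrite EFinM; apply: lee_wpmul2l => //.
  by rewrite lee_fin ltW.
(* with t = M^(1/n), all powers become powers of M *)
have G : M `^ ((\sum_i gam i) / n%:R) = \prod_i t `^ gam i.
  by rewrite -powR_sum// /t -powRrM mulrC.
have n0' : n%:R != 0 :> R by rewrite pnatr_eq0 -lt0n.
have m0' : m%:R != 0 :> R by rewrite pnatr_eq0 -lt0n.
have gamE : \sum_i gam i = m%:R * n%:R - \sum_i b i + delta.
  rewrite big_split/= sumrB !sumr_const !card_ord -[n%:R *+ m]mulr_natl.
  by rewrite -[delta / _ *+ m]mulr_natl mulrCA divff// mulr1.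
move: Hfin; rewrite !mulrA ler_pM2r// /c big_split/= -G -!mulrA.
rewrite -powRD ?(lt0r_neq0 M0) ?implybT// !mulrA -ler_pdivrMr ?powR_gt0// -powRN -powRD ?(lt0r_neq0 M0) ?implybT//.
congr (_ `^ _ <= _); rewrite gamE.
by field.
Qed.
End ball_estimate.

Theorem theorem1p3 (R : realType) (n m : nat) (delta beta dt : R)
    (p : 'I_m -> \bar R) (v : 'I_m -> 'rV[R]_n -> \bar R) :
  (0 < n)%N -> (0 < m)%N ->
  0 < beta < m%:R * n%:R ->
  (forall i : 'I_m, (1 <= p i)%E) ->
  Hclass delta p beta dt v ->
  (1 < xi_exponent p)%E ->
  (dt%:E = beta%:E - n%:R%:E / total_exponent p)%E.
Proof.
move=> n0 m0 _ p1 [_ wv wV [b [_ bsum [C C0 HC]]]] xi1.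
have p0 i : (0 < p i)%E by apply: lt_le_trans (p1 i).
(* s i is 1 / p_i and th i is the reciprocal of the conjugate exponent *)
pose s i : R := fine (p i)^-1%E.
have sE i : (p i)^-1%E = (s i)%:E.
  rewrite /s fineK// fin_numV ?gt_eqF//.
  by apply: lt_trans (p0 i).
pose th i := 1 - s i.
have thE i : (hoelder_conjugate (p i))^-1%E = (th i)%:E.
  have := @hoelder_conjugate_eq1 R (p i) (lt_trans ltNy0 (p0 i)).
  rewrite gt_eqF// => /(_ isT); rewrite sE /th.
  by case: (_^-1)%E => // u [<-]; rewrite addrAC subrr add0r.
have th0 i : 0 <= th i.
  rewrite -lee_fin -thE inve_ge0.
  by apply: le_trans (hoelder_conj_ge1 (p1 i)).
have SE : (\sum_(i < m) (p i)^-1)%E = (\sum_i s i)%:E.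
  by rewrite -sumEFin; apply: eq_bigr.
have thS : \sum_i th i = m%:R - \sum_i s i.
  by rewrite /th sumrB sumr_const card_ord.
have th1 : \sum_i th i <= 1.
  move: xi1; rewrite /xi_exponent /total_exponent inveK SE -EFinB -thS.
  rewrite inve_gt1 ?lee_fin ?sumr_ge0// lte_fin.
  exact: ltW.
have n0' : (0 : R) < n%:R by rewrite ltr0n.
pose K := C * \prod_i (1 + n%:R) `^ `|n%:R - b i + delta / m%:R|.
have key r : 0 < r -> exists M : R, [/\ 0 < M, (r / n%:R) ^+ n <= M,
    M <= (2 * r) ^+ n & M `^ ((beta - dt) / n%:R + \sum_i th i - m%:R) <=
    K].
  move=> r0; have [M [muM Ml Mu]] := lebesgue_eball0 n0 r0.
  have M0 : 0 < M by apply: lt_le_trans Ml; rewrite exprn_gt0// divr_gt0.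
  exists M; split=> //; rewrite -bsum.
  apply: (Hquantity_eball0 n0 m0 p1 thE th1 wv wV r0 M0 C0 muM _ (HC 0 r r0)).
  rewrite mulrC -ler_pdivrMr//.
  have rn0 : 0 <= r / n%:R by rewrite divr_ge0// ltW.
  have -> : r / n%:R = ((r / n%:R) ^+ n) `^ n%:R^-1.
    by rewrite -powR_mulrn// -powRrM mulfV ?powRr1// gt_eqF.
  apply: ge0_ler_powR => //.
    by rewrite nnegrE exprn_ge0.
  by rewrite nnegrE ltW.
have : (beta - dt) / n%:R + \sum_i th i - m%:R = 0.
  apply: (@powR_bounded_eq0 _ _ K) => l l0.
  - have [|M [_ lM _ MC]] := key (n%:R * (l + 1)).
      by rewrite mulr_gt0// addr_gt0.
    exists M => //; apply: (le_trans _ lM).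
    rewrite mulrAC divff ?mul1r ?gt_eqF//.
    apply: (@le_trans _ _ (l + 1)); first by rewrite lerDl.
    by apply: ler_eXnr => //; rewrite lerDr ltW.
  - have l1 : 0 < Num.min l 1 by rewrite lt_min l0 ltr01.
    have [|M [M0 _ Ml MC]] := key (Num.min l 1 / 2); first by rewrite divr_gt0.
    exists M => //; rewrite M0/=; apply: le_trans Ml _.
    rewrite mulrCA divff// mulr1.
    apply: (@le_trans _ _ (Num.min l 1)); last by rewrite ge_min lexx.
    by apply: ler_iXnr => //; rewrite ?(ltW l1) ?ge_min ?lexx ?orbT.
rewrite thS => e0.
rewrite /total_exponent inveK SE -EFinM -EFinB; congr (_%:E).
have -> : \sum_i s i = (beta - dt) / n%:R by lra.
by rewrite mulrCA divff ?gt_eqF// mulr1; lra.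
Qed.
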